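(* Let $G$ be a series-parallel graph. Then $G$ is $C_5$-critical if and only if there is $i\in\{0,1,2\}$ such that $G$ (as a graph, forgetting terminals) is isomorphic to a parallel sum $G_1\,\|\,G_2$ with $G_1\in\mathcal{F}_{\mathbf{s}(i)}$ and $G_2\in\mathcal{F}_{\bar{\mathbf{s}}(i)}$.
   Context: For graphs $G,H$, an $H$-colouring of $G$ is a map $\phi:V(G)\to V(H)$ sending adjacent vertices to adjacent vertices. We take $V(C_n)=\mathbb{Z}_n$ with $u,v$ adjacent iff $u-v=\pm1$. A graph is $C_{n}$-critical if it has no $C_{n}$-colouring but every proper subgraph has one. A 2-terminal graph $(G,s,t)$ is a graph with two distinct distinguished vertices (terminals) $s,t$. The serial sum $(G_1,s_1,t_1)+(G_2,s_2,t_2)$ is obtained by identifying $t_1$ with $s_2$, with terminals $s_1,t_2$. The parallel sum $(G_1,s_1,t_1)\,\|\,(G_2,s_2,t_2)$ is obtained by identifying $s_1$ with $s_2$ (new terminal $s$) and $t_1$ with $t_2$ (new terminal $t$). A graph $G$ is series-parallel if for some choice of terminals $s,t$, $(G,s,t)$ can be built from single edges ($K_2$ with its two ends as terminals) by serial and parallel sums; a 2-terminal series-parallel graph is such a $(G,s,t)$. For a nonempty $S\subseteq\mathbb{Z}_n$, $(G,s,t)$ is $S$-forcing (with respect to $C_n$) if $S=\{x\in\mathbb{Z}_n:\exists$ a $C_n$-colouring $\phi$ of $G$ with $\phi(s)=0,\phi(t)=x\}$; it is minimally $S$-forcing if it is $S$-forcing but no proper subgraph $(G',s,t)$ (with the same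 terminals) is $S$-forcing. Here $n=5$. For $i\in\mathbb{Z}_5$, $\mathbf{s}(i)=\{i,-i\}$ and $\bar{\mathbf{s}}(i)=\mathbb{Z}_5\setminus\{i,-i\}$. For a symmetric $S\subseteq\mathbb{Z}_5$, $\mathcal{F}_S$ denotes the family of all minimally $S$-forcing 2-terminal series-parallel graphs (with respect to $C_5$). *)

(* Defs.v *)
From HB Require Import structures.
From mathcomp Require Import all_boot all_order all_algebra.

Set Implicit Arguments.
Unset Strict Implicit.
Unset Printing Implicit Defensive.

Import GRing.Theory.
Local Open Scope ring_scope.

(* Graphs are finite and simple.  Consequently, when an identification of
   vertices makes two edges parallel, those edges are merged. *)
Record sgraph := SGraph {
  vert :> finType;
  adj : rel vert;
  adj_sym : symmetric adj;
  adj_irr : irreflexive adj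
}.
Arguments adj {s} : rename.

Definition sg_iso (G H : sgraph) : Prop :=
  exists2 f : G -> H, bijective f & forall x y, adj (f x) (f y) = adj x y.

Definition colouring (G H : sgraph) (phi : G -> H) : Prop :=
  forall u v, adj u v -> adj (phi u) (phi v).

Definition colourable (H G : sgraph) : Prop :=
  exists phi : G -> H, colouring phi.

(* A subgraph is a set of vertices together with a set of edges, each of which
   is an edge of G with both ends in that vertex set. *)
Record subgraph (G : sgraph) := Subgraph {
  sub_vert : {set G};
  sub_adj : rel G;
  sub_adj_sym : symmetric sub_adj;
  sub_adjP : forall u v,
    sub_adj u v -> [/\ adj u v, u \in sub_vert & v \in sub_vert]
}.

Section SubgraphAsGraph.
Variables (G : sgraph) (H : subgraph G).

Definition sub_rel (u v : {x : G | x \in sub_vert H}) := sub_adj H (val u) (val v).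

Fact sub_rel_sym : symmetric sub_rel.
Proof. by move=> u v; apply: sub_adj_sym. Qed.

Fact sub_rel_irr : irreflexive sub_rel.
Proof.
move=> u; apply/negbTE/negP => /sub_adjP[].
by rewrite adj_irr.
Qed.

Definition sub_graph : sgraph := SGraph sub_rel_sym sub_rel_irr.

Definition proper_subgraph : Prop :=
  sub_vert H != [set: G] \/ exists u v, adj u v && ~~ sub_adj H u v.

End SubgraphAsGraph.

Definition critical (H G : sgraph) : Prop :=
  ~ colourable H G /\
  forall G' : subgraph G, proper_subgraph G' -> colourable H (sub_graph G').

Section Cycle.
Variable n : nat.

Definition cycle_rel (u v : 'Z_n) := (u - v == 1) || (u - v == -1).

Fact cycle_rel_sym : symmetric cycle_rel.
Proof. by move=> u v; rewrite /cycle_rel -opprB !eqr_oppLR opprK orbC. Qed.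

Fact cycle_rel_irr : irreflexive cycle_rel.
Proof.
by move=> u; rewrite /cycle_rel subrr eq_sym oner_eq0 eq_sym oppr_eq0 oner_eq0.
Qed.

(* C_n, for n >= 3 only: 'Z_n is the ring of integers modulo maxn n 2. *)
Definition cycle_graph : sgraph := SGraph cycle_rel_sym cycle_rel_irr.

End Cycle.

Record tgraph := TGraph {
  tg_graph :> sgraph;
  src : tg_graph;
  tgt : tg_graph;
  src_neq_tgt : src != tgt
}.
Arguments src {t} : rename.
Arguments tgt {t} : rename.

Definition tg_iso (G H : tgraph) : Prop :=
  exists f : G -> H,
    [/\ bijective f, forall x y, adj (f x) (f y) = adj x y,
        f src = src & f tgt = tgt].

Definition image_rel (G : sgraph) (U : finType) (f : G -> U) : rel U :=
  fun u v => [exists x, [exists y, [&& adj x y, f x == u & f y == v]]].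

Section Glue.
Variables (G1 G2 : sgraph) (U : finType) (f1 : G1 -> U) (f2 : G2 -> U).
Hypotheses (f1_inj : injective f1) (f2_inj : injective f2).

Definition glue_rel : rel U := fun u v => image_rel f1 u v || image_rel f2 u v.

Fact glue_rel_sym : symmetric glue_rel.
Proof.
have sym (G : sgraph) (f : G -> U) : symmetric (image_rel f).
  by move=> u v; apply/idP/idP => /existsP[x /existsP[y /and3P[xy xu yv]]];
    apply/existsP; exists y; apply/existsP; exists x;
    rewrite adj_sym xy xu yv.
by move=> u v; rewrite /glue_rel !(sym _ _ u).
Qed.

Fact glue_rel_irr : irreflexive glue_rel.
Proof.
have irr (G : sgraph) (f : G -> U) : injective f -> irreflexive (image_rel f).
  move=> f_inj u; apply/negbTE/negP => /existsP[x /existsP[y /and3P[xy /eqP <- /eqP]]].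
  by move/f_inj=> yx; rewrite yx adj_irr in xy.
by move=> u; rewrite /glue_rel !irr.
Qed.

(* The graph on U whose edges are the images of those of G1 and of G2. *)
Definition glue : sgraph := SGraph glue_rel_sym glue_rel_irr.

End Glue.

Section Sums.
Variables G1 G2 : tgraph.

(* The serial sum keeps all vertices of G1 and those of G2 other than its
   source, which is sent to the target of G1. *)
Definition serial_vert : finType := (G1 + {x : G2 | x != src})%type.

Definition serial_inl (x : G1) : serial_vert := inl x.

Definition serial_inr (x : G2) : serial_vert :=
  if insub x is Some y then inr y else inl tgt.

Fact serial_inl_inj : injective serial_inl.
Proof. by move=> x y []. Qed.

Fact serial_inr_inj : injective serial_inr.
Proof.
move=> x y; rewrite /serial_inr.
case: insubP => [u _ <-|/negPn/eqP->]; case: insubP => [v _ <-|/negPn/eqP->] //.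
by move=> [->].
Qed.

Fact serial_src_neq_tgt : serial_inl src != serial_inr tgt.
Proof.
by rewrite /serial_inr; case: insubP => //; rewrite eq_sym src_neq_tgt.
Qed.

Definition serial_sum : tgraph :=
  @TGraph (glue serial_inl_inj serial_inr_inj) _ _ serial_src_neq_tgt.

(* The parallel sum keeps all vertices of G1 and the non-terminal vertices
   of G2, whose terminals are sent to those of G1. *)
Definition parallel_vert : finType :=
  (G1 + {x : G2 | (x != src) && (x != tgt)})%type.

Definition parallel_inl (x : G1) : parallel_vert := inl x.

Definition parallel_inr (x : G2) : parallel_vert :=
  if insub x is Some y then inr y else inl (if x == src then src else tgt).

Fact parallel_inl_inj : injective parallel_inl.
Proof. by move=> x y []. Qed.

Fact parallel_inr_inj : injective parallel_inr.
Proof.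
have st1 := negbTE (src_neq_tgt G1); have st2 := negbTE (src_neq_tgt G2).
move=> x y; rewrite /parallel_inr.
case: insubP => [u _ <-|]; case: insubP => [v _ <-|] //; first by move=> [->].
rewrite !negb_and !negbK => /orP[]/eqP-> /orP[]/eqP-> //=.
  by rewrite eqxx [tgt == _]eq_sym st2 => -[] /eqP; rewrite eq_sym st1.
by rewrite eqxx [tgt == _]eq_sym st2 => -[] /eqP; rewrite st1.
Qed.

Fact parallel_src_neq_tgt : parallel_inl src != parallel_inl tgt.
Proof. by apply/eqP => -[] /eqP; rewrite (negbTE (src_neq_tgt G1)). Qed.

Definition parallel_sum : tgraph :=
  @TGraph (glue parallel_inl_inj parallel_inr_inj) _ _ parallel_src_neq_tgt.

End Sums.

Section SingleEdge.

Definition edge_rel (u v : bool) := u != v.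

Fact edge_rel_sym : symmetric edge_rel.
Proof. by move=> u v; rewrite /edge_rel eq_sym. Qed.

Fact edge_rel_irr : irreflexive edge_rel.
Proof. by move=> u; rewrite /edge_rel eqxx. Qed.

Definition single_edge : tgraph :=
  @TGraph (SGraph edge_rel_sym edge_rel_irr) false true isT.

End SingleEdge.

Inductive tseries_parallel : tgraph -> Prop :=
| tsp_edge : tseries_parallel single_edge
| tsp_serial G1 G2 :
    tseries_parallel G1 -> tseries_parallel G2 ->
    tseries_parallel (serial_sum G1 G2)
| tsp_parallel G1 G2 :
    tseries_parallel G1 -> tseries_parallel G2 ->
    tseries_parallel (parallel_sum G1 G2)
| tsp_iso G H : tg_iso G H -> tseries_parallel G -> tseries_parallel H.

Definition series_parallel (G : sgraph) : Prop :=
  exists (s t : G) (st : s != t), tseries_parallel (TGraph st).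

Definition forcing n (S : {set 'Z_n}) (G : tgraph) : Prop :=
  S != set0 /\
  forall x : 'Z_n, x \in S <->
    exists phi : G -> 'Z_n,
      [/\ @colouring G (cycle_graph n) phi, phi src = 0 & phi tgt = x].

Definition sub_tgraph (G : tgraph) (H : subgraph G)
    (sH : src \in sub_vert H) (tH : tgt \in sub_vert H) : tgraph :=
  @TGraph (sub_graph H) (exist _ src sH) (exist _ tgt tH) (src_neq_tgt G).

Definition minimally_forcing n (S : {set 'Z_n}) (G : tgraph) : Prop :=
  forcing S G /\
  forall (H : subgraph G) (sH : src \in sub_vert H) (tH : tgt \in sub_vert H),
    proper_subgraph H -> ~ forcing S (sub_tgraph sH tH).

Definition sset (i : 'Z_5) : {set 'Z_5} := [set i; - i].

Definition sbar (i : 'Z_5) : {set 'Z_5} := ~: sset i.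

Definition minforcing_family (S : {set 'Z_5}) (G : tgraph) : Prop :=
  tseries_parallel G /\ minimally_forcing S G.

(* Main.v *)
(* Write gaps(G) for the set of values phi(t) - phi(s) over all colourings phi
   of (G, s, t).  It is symmetric, parallel sums intersect it and serial sums
   add it, so G1 || G2 has no colouring iff gaps(G1) and gaps(G2) are disjoint.

   If a pair G1, G2 of parallel parts makes up a critical graph, then their
   gaps are nonempty disjoint unions of the classes {0}, {1,-1}, {2,-2}.
   Either the gaps are complementary, hence of the form s(i) and its
   complement, and minimality is inherited from criticality; or they are s(i)
   and s(j) with i, j in different classes, and one of them, say i, is 0 or 2.
   The latter contradicts criticality: for i in {0, 2}, a series-parallel graph
   with gaps s(i) has a proper subgraph with j not among its gaps.  Indeed, if
   it is a parallel sum then j is not a gap of one of the two parts, and if it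
   is a serial sum then one part has gaps {0} and the other has gaps s(i), so
   one can recurse into the latter.

   Conversely, deleting an edge from a minimally forcing part only enlarges its
   gaps, which then meet those of the other part. *)
Require Import Defs.
From mathcomp Require Import all_boot all_order all_algebra.
From mathcomp Require Import ring.

Set Implicit Arguments.
Unset Strict Implicit.
Unset Printing Implicit Defensive.

Import GRing.Theory.
Local Open Scope ring_scope.

(** * Colourings by the 5-cycle and their gaps *)

Lemma Z5_ind (P : 'Z_5 -> Prop) :
  P 0 -> P 1 -> P 2 -> P (- 1) -> P (- 2) -> forall x, P x.
Proof.
move=> P0 P1 P2 P4 P3 [[|[|[|[|[|//]]]]] lt_m].
- by rewrite (_ : Ordinal _ = 0) //; apply: val_inj.
- by rewrite (_ : Ordinal _ = 1) //; apply: val_inj.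
- by rewrite (_ : Ordinal _ = 2) //; apply: val_inj.
- by rewrite (_ : Ordinal _ = - 2) //; apply: val_inj.
- by rewrite (_ : Ordinal _ = - 1) //; apply: val_inj.
Qed.

Local Notation colouring5 G phi := (@colouring G (cycle_graph 5) phi).

(** Rotations of the 5-cycle preserve colourings, so the difference of the end colours gives the
    same set as normalising the colour of [s] to 0, and it restricts to subgraphs without a
    shift. *)
Definition gaps (G : sgraph) (s t : G) : {set 'Z_5} :=
  [set x | [exists phi : {ffun G -> 'Z_5},
     [forall u, forall v, adj u v ==> cycle_rel (phi u) (phi v)]
     && (phi t - phi s == x)]].

Lemma gapsP (G : sgraph) (s t : G) x :
  reflect (exists phi : G -> 'Z_5, colouring5 G phi /\ phi t - phi s = x)
          (x \in gaps s t).
Proof.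
rewrite inE; apply: (iffP existsP) => [[phi /andP[/forallP c /eqP <-]]|[phi [c <-]]].
  by exists phi; split=> // u v uv; apply: (implyP (forallP (c u) v)).
exists (finfun phi); rewrite !ffunE eqxx andbT.
by apply/forallP => u; apply/forallP => v; apply/implyP => /c; rewrite !ffunE.
Qed.

Lemma colouring_shift (G : sgraph) (phi : G -> 'Z_5) c :
  colouring5 G phi -> colouring5 G (fun v => phi v + c).
Proof.
move=> col u v /col; rewrite /= /cycle_rel.
by rewrite opprD addrACA subrr addr0.
Qed.

Lemma colouring_opp (G : sgraph) (phi : G -> 'Z_5) :
  colouring5 G phi -> colouring5 G (fun v => - phi v).
Proof.
move=> col u v uv; have := col v u; rewrite adj_sym => /(_ uv).
by rewrite /= /cycle_rel opprK addrC.
Qed.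

Lemma gapsN (G : sgraph) (s t : G) x : (- x \in gaps s t) = (x \in gaps s t).
Proof.
suff sub y : y \in gaps s t -> - y \in gaps s t.
  by apply/idP/idP => /sub //; rewrite opprK.
case/gapsP=> phi [col <-]; apply/gapsP; exists (fun v => - phi v).
by split; [exact: colouring_opp | rewrite opprB opprK addrC].
Qed.

Lemma forcingP (S : {set 'Z_5}) (G : tgraph) :
  forcing S G <-> S != set0 /\ S = gaps (@src G) tgt.
Proof.
have gapsE x : (x \in gaps (@src G) tgt) <-> exists phi : G -> 'Z_5,
    [/\ colouring5 G phi, phi src = 0 & phi tgt = x].
  split=> [/gapsP[phi [col <-]]|[phi [col p0 <-]]].
    exists (fun v => phi v + - phi src); split=> //; last exact: subrr.
    exact: colouring_shift.
  by apply/gapsP; exists phi; rewrite p0 subr0.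
split=> -[S0 SE]; split=> //.
  by apply/setP => x; apply/idP/idP => [/SE/gapsE|/gapsE/SE].
by move=> x; rewrite SE.
Qed.

Lemma colourable_gaps (G : sgraph) (s t : G) :
  colourable (cycle_graph 5) G <-> gaps s t != set0.
Proof.
split=> [[phi col]|/set0Pn[x /gapsP[phi [col _]]]]; last by exists phi.
by apply/set0Pn; exists ((phi t : 'Z_5) - phi s); apply/gapsP; exists phi.
Qed.

(** * Embeddings and the edges they miss *)

Definition embeds (K G : sgraph) (f : K -> G) :=
  injective f /\ forall x y, adj x y -> adj (f x) (f y).

(** Properness is measured by missing edges alone, which suffices for graphs without isolated
    vertices. *)
Definition misses (K G : sgraph) (f : K -> G) :=
  [exists u, exists v, adj u v && ~~ image_rel f u v].

Definition no_isolated (G : sgraph) := forall x : G, exists y, adj x y.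

Lemma image_relP (G : sgraph) (U : finType) (f : G -> U) u v :
  reflect (exists x y, [/\ adj x y, f x = u & f y = v]) (image_rel f u v).
Proof.
apply: (iffP existsP) => [[x /existsP[y /and3P[xy /eqP fx /eqP fy]]]|].
  by exists x, y.
by move=> [x [y [xy <- <-]]]; exists x; apply/existsP; exists y; rewrite xy !eqxx.
Qed.

Lemma missesP (K G : sgraph) (f : K -> G) :
  reflect (exists u v, adj u v /\ ~ image_rel f u v) (misses f).
Proof.
apply: (iffP existsP) => [[u /existsP[v /andP[uv /negP fuv]]]|[u [v [uv /negP fuv]]]].
  by exists u, v.
by exists u; apply/existsP; exists v; rewrite uv.
Qed.

Lemma missesPn (K G : sgraph) (f : K -> G) :
  ~~ misses f -> forall u v, adj u v -> image_rel f u v.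
Proof.
move=> f_full u v uv; apply: contraNT f_full => /negP fuv.
by apply/missesP; exists u, v.
Qed.

Lemma embeds_comp (K G H : sgraph) (f : K -> G) (g : G -> H) :
  embeds f -> embeds g -> embeds (g \o f).
Proof. by move=> [fi fh] [gi gh]; split; [exact: inj_comp | move=> x y /fh /gh]. Qed.

Lemma misses_comp (K G H : sgraph) (f : K -> G) (g : G -> H) :
  misses f -> embeds g -> misses (g \o f).
Proof.
move=> /missesP[u [v [uv fuv]]] [gi gh]; apply/missesP; exists (g u), (g v).
split; first exact: gh.
move=> /image_relP[x [y [xy /gi fx /gi fy]]].
by apply: fuv; apply/image_relP; exists x, y.
Qed.

(** The default [c] colours the points outside both images, which no edge of a glued graph
    touches. *)
Lemma common_extension (A B U : finType) (C : Type) (c : C)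
    (f : A -> U) (g : B -> U) (phi : A -> C) (psi : B -> C) :
  injective f -> injective g -> (forall x y, f x = g y -> phi x = psi y) ->
  exists chi : U -> C, (forall x, chi (f x) = phi x) /\ (forall y, chi (g y) = psi y).
Proof.
move=> fi gi compat.
exists (fun v => if [pick x | f x == v] is Some x then phi x
         else if [pick y | g y == v] is Some y then psi y else c).
split=> [x|y].
  by case: pickP => [x' /eqP/fi -> //|/(_ x)]; rewrite eqxx.
case: pickP => [x /eqP/compat //|_].
by case: pickP => [y' /eqP/gi -> //|/(_ y)]; rewrite eqxx.
Qed.

(** Every edge of [G] comes from [K], so vertices outside the image of [f] are isolated and may take
    any colour. *)
Lemma gaps_full (K G : sgraph) (f : K -> G) (s t : K) :
  embeds f -> ~~ misses f -> gaps s t \subset gaps (f s) (f t).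
Proof.
move=> [fi fh] f_full; apply/subsetP => x /gapsP[phi [col <-]].
have [|chi [chif _]] := @common_extension _ _ _ 'Z_5 0 _ _ phi phi fi fi.
  by move=> y z /fi ->.
apply/gapsP; exists chi; rewrite !chif; split=> // u v /(missesPn f_full).
by move=> /image_relP[y [z [yz <- <-]]]; rewrite !chif; apply: col.
Qed.

(** The image of [f], kept with all vertices of [G], is a proper subgraph, and a colouring of it
    pulls back along [f]. *)
Lemma critical_misses (K G : sgraph) (f : K -> G) :
  critical (cycle_graph 5) G -> embeds f -> misses f ->
  colourable (cycle_graph 5) K.
Proof.
move=> [_ crit] [fi fh] /missesP[u [v [uv fuv]]].
have sym : symmetric (image_rel f).
  move=> a b; apply/image_relP/image_relP => -[x [y [xy xa yb]]];
    by exists y, x; rewrite adj_sym.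
have sub a b : image_rel f a b -> [/\ adj a b, a \in [set: G] & b \in [set: G]].
  by move=> /image_relP[x [y [/fh xy <- <-]]]; rewrite !in_setT.
have [|phi col] := crit (Subgraph sym sub).
  by right; exists u, v; rewrite uv /=; apply/negP.
exists (fun x => phi (exist _ (f x) (in_setT _))) => x y xy.
by apply: col; apply/image_relP; exists x, y.
Qed.

Lemma proper_misses (G : sgraph) (H : subgraph G) :
  no_isolated G -> proper_subgraph H ->
  embeds (val : sub_graph H -> G) /\ misses (val : sub_graph H -> G).
Proof.
move=> noiso prop.
have img a b : image_rel (val : sub_graph H -> G) a b -> sub_adj H a b.
  by move=> /image_relP[x [y [xy <- <-]]].
split; first by split; [exact: val_inj | move=> x y /sub_adjP[]].
apply/missesP; case: prop => [|[u [v /andP[uv nuv]]]]; last first.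
  by exists u, v; split=> // /img; apply/negP.
(* A dropped vertex lies on some edge, which is then dropped too. *)
rewrite -subTset => /subsetPn[u _ uH]; have [v uv] := noiso u.
by exists u, v; split=> // /img /sub_adjP[_ /(negP uH)].
Qed.

(** * Gluing two graphs: gaps and missed edges *)

Lemma gaps_parallel (A B : sgraph) (U : finType) (f : A -> U) (g : B -> U)
    (fi : injective f) (gi : injective g) (sA tA : A) (sB tB : B) :
  f sA = g sB -> f tA = g tB ->
  (forall x y, f x = g y -> (x = sA /\ y = sB) \/ (x = tA /\ y = tB)) ->
  @gaps (glue fi gi) (f sA) (f tA) = gaps sA tA :&: gaps sB tB.
Proof.
move=> es et ov; apply/setP => x; rewrite in_setI; apply/gapsP/andP.
  move=> [chi [col <-]]; split; apply/gapsP.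
    exists (chi \o f); split=> // u v uv; apply: col.
    by apply/orP; left; apply/image_relP; exists u, v.
  exists (chi \o g); split=> [u v uv|]; last by rewrite /= es et.
  by apply: col; apply/orP; right; apply/image_relP; exists u, v.
move=> [/gapsP[phi [colA <-]] /gapsP[psi [colB e]]].
(* A rotation makes the second colouring agree with the first at the source; equality of the gaps
   then makes them agree at the target. *)
pose psi' y := psi y + (phi sA - psi sB).
have psiE : psi' tB = phi tA.
  by rewrite /psi' addrCA e addrC subrK.
have [|chi [chif chig]] := @common_extension _ _ _ 'Z_5 0 _ _ phi psi' fi gi.
  move=> a b /ov[[-> ->]|[-> ->]]; last by rewrite psiE.
  by rewrite /psi' addrC subrK.
exists chi; rewrite !chif; split=> // u v /orP[]/image_relP[a [b [ab <- <-]]].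
  by rewrite !chif; apply: colA.
by rewrite !chig; apply: (colouring_shift _ colB).
Qed.

Lemma gaps_serial (A B : sgraph) (U : finType) (f : A -> U) (g : B -> U)
    (fi : injective f) (gi : injective g) (sA tA : A) (sB tB : B) x :
  f tA = g sB -> (forall x y, f x = g y -> x = tA /\ y = sB) ->
  reflect (exists a b, [/\ a \in gaps sA tA, b \in gaps sB tB & x = a + b])
    (x \in @gaps (glue fi gi) (f sA) (g tB)).
Proof.
move=> e ov; apply: (iffP (gapsP _ _ _)).
  move=> [chi [col <-]]; exists (chi (f tA) - chi (f sA)), (chi (g tB) - chi (g sB)).
  split; last by rewrite e; ring.
    apply/gapsP; exists (chi \o f); split=> // u v uv; apply: col.
    by apply/orP; left; apply/image_relP; exists u, v.
  apply/gapsP; exists (chi \o g); split=> // u v uv; apply: col.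
  by apply/orP; right; apply/image_relP; exists u, v.
move=> [a [b [/gapsP[phi [colA <-]] /gapsP[psi [colB <-]] ->]]].
pose psi' y := psi y + (phi tA - psi sB).
have [|chi [chif chig]] := @common_extension _ _ _ 'Z_5 0 _ _ phi psi' fi gi.
  by move=> u v /ov[-> ->]; rewrite /psi' addrC subrK.
exists chi; rewrite !chif !chig; split; last first.
  by rewrite /psi'; ring.
move=> u v /orP[]/image_relP[x1 [y1 [ab <- <-]]].
  by rewrite !chif; apply: colA.
by rewrite !chig; apply: (colouring_shift _ colB).
Qed.

Lemma gaps_embed (K G : sgraph) (f : K -> G) (s t : K) :
  embeds f -> gaps (f s) (f t) \subset gaps s t.
Proof.
move=> [_ fh]; apply/subsetP => x /gapsP[phi [col <-]].
by apply/gapsP; exists (phi \o f); split=> // u v /fh; apply: col.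
Qed.

Section Glue.
Variables (A B : sgraph) (U : finType) (f : A -> U) (g : B -> U).
Hypotheses (fi : injective f) (gi : injective g).

Lemma glue_embedsl : @embeds A (glue fi gi) f.
Proof. by split=> // x y xy; apply/orP; left; apply/image_relP; exists x, y. Qed.

Lemma glue_embedsr : @embeds B (glue fi gi) g.
Proof. by split=> // x y xy; apply/orP; right; apply/image_relP; exists x, y. Qed.

End Glue.

(** Parallel edges are merged, so an edge present in both parts would survive its deletion from one
    of them. *)
Definition edge_disjoint (A B G : sgraph) (f : A -> G) (g : B -> G) :=
  forall u v, image_rel f u v -> image_rel g u v -> False.

Lemma glue_misses (A B K L G : sgraph) (f : A -> G) (g : B -> G)
    (h : K -> A) (k : L -> B)
    (fhi : injective (f \o h)) (gki : injective (g \o k)) :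
  embeds f -> embeds g -> embeds h -> embeds k -> edge_disjoint f g ->
  misses h || misses k ->
  @embeds (glue fhi gki) G id /\ @misses (glue fhi gki) G id.
Proof.
move=> [fi fh] [gi gh] [hi hh] [ki kh] dis mis; split.
  split=> // u v /orP[]/image_relP[x [y [xy <- <-]]] /=.
    exact/fh/hh.
  exact/gh/kh.
apply/missesP; case/orP: mis => /missesP[x [y [xy nxy]]].
  exists (f x), (f y); split; first exact: fh.
  move=> /image_relP[u [v [uv /= eu ev]]]; move: uv; rewrite eu ev => /orP[].
    move=> /image_relP[a [b [ab /fi ax /fi yb]]].
    by apply: nxy; apply/image_relP; exists a, b.
  move=> /image_relP[a [b [ab ax yb]]]; apply: (dis (f x) (f y)).
    by apply/image_relP; exists x, y.
  by apply/image_relP; exists (k a), (k b); split=> //; apply: kh.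
exists (g x), (g y); split; first exact: gh.
move=> /image_relP[u [v [uv /= eu ev]]]; move: uv; rewrite eu ev => /orP[].
  move=> /image_relP[a [b [ab ax yb]]]; apply: (dis (g x) (g y)).
    by apply/image_relP; exists (h a), (h b); split=> //; apply: hh.
  by apply/image_relP; exists x, y.
move=> /image_relP[a [b [ab /gi ax /gi yb]]].
by apply: nxy; apply/image_relP; exists a, b.
Qed.

(** * Overlap of the summands, and absence of isolated vertices *)

Lemma serial_inr_src (A B : tgraph) :
  serial_inr A (@src B) = serial_inl B tgt.
Proof. by rewrite /serial_inr insubF // eqxx. Qed.

Lemma serial_overlap (A B : tgraph) (x : A) (y : B) :
  serial_inl B x = serial_inr A y -> x = tgt /\ y = src.
Proof. by rewrite /serial_inr; case: insubP => // /negPn/eqP-> [->]. Qed.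

Lemma parallel_inr_src (A B : tgraph) :
  parallel_inr A (@src B) = parallel_inl B src.
Proof. by rewrite /parallel_inr insubF eqxx. Qed.

Lemma parallel_inr_tgt (A B : tgraph) :
  parallel_inr A (@tgt B) = parallel_inl B tgt.
Proof.
by rewrite /parallel_inr insubF ?eqxx ?andbF // eq_sym (negbTE (src_neq_tgt B)).
Qed.

Lemma parallel_overlap (A B : tgraph) (x : A) (y : B) :
  parallel_inl B x = parallel_inr A y ->
  (x = src /\ y = src) \/ (x = tgt /\ y = tgt).
Proof.
rewrite /parallel_inr; case: insubP => // /nandP[] /negPn/eqP-> [->].
  by rewrite eqxx; left.
by rewrite eq_sym (negbTE (src_neq_tgt B)); right.
Qed.

Lemma glue_no_isolated (A B : sgraph) (U : finType) (f : A -> U) (g : B -> U)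
    (fi : injective f) (gi : injective g) :
  no_isolated A -> no_isolated B ->
  (forall u, (exists x, f x = u) \/ (exists y, g y = u)) ->
  no_isolated (glue fi gi).
Proof.
move=> nA nB cover u; case: (cover u) => -[x <-].
  by have [y xy] := nA x; exists (f y); apply: (glue_embedsl fi gi).2.
by have [y xy] := nB x; exists (g y); apply: (glue_embedsr fi gi).2.
Qed.

Lemma tsp_no_isolated (T : tgraph) : tseries_parallel T -> no_isolated T.
Proof.
elim=> [|A B _ nA _ nB|A B _ nA _ nB|G H [f [[g fK gK] fE _ _]] _ nG].
- by move=> x; exists (~~ x); case: x.
- apply: glue_no_isolated => // -[x|y]; [by left; exists x | right].
  by exists (val y); rewrite /serial_inr valK.
- apply: glue_no_isolated => // -[x|y]; [by left; exists x | right].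
  by exists (val y); rewrite /parallel_inr valK.
by move=> x; have [y xy] := nG (g x); exists (f y); rewrite -(gK x) fE.
Qed.

(** * Proper subgraphs that still exclude a given gap *)

(** Two elements of [sset i] agree up to sign, and [a + b] equal to [a - b] or to its opposite makes
    [b] or [a] vanish, as 2 is invertible modulo 5. *)
Lemma sset_sum (i a b : 'Z_5) :
  i \in [set 0; 2] -> a + b \in sset i -> a - b \in sset i ->
  (a == 0) && (b \in sset i) || (b == 0) && (a \in sset i).
Proof.
by rewrite !inE => /orP[]/eqP->; move: a b;
  apply: Z5_ind; apply: Z5_ind.
Qed.

(** Deleting edges can only add gaps, so this is stronger than the absence of [j] from the gaps of
    [G]. *)
Definition reducible (G : sgraph) (s t : G) (j : 'Z_5) :=
  exists (K : sgraph) (s' t' : K) (f : K -> G),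
    [/\ embeds f, misses f, f s' = s, f t' = t & j \notin gaps s' t'].

Lemma reducible_embed (K G : sgraph) (f : K -> G) (s t : K) j :
  embeds f -> reducible s t j -> reducible (f s) (f t) j.
Proof.
move=> fe [L [s' [t' [h [he hm <- <- nj]]]]].
exists L, s', t', (f \o h); split=> //; first exact: embeds_comp.
exact: misses_comp.
Qed.

Lemma reducible_part (A G : sgraph) (f : A -> G) (s t : A) (S : {set 'Z_5}) j :
  embeds f -> j \notin gaps s t -> gaps (f s) (f t) \subset S ->
  (gaps s t \subset S -> reducible s t j) -> reducible (f s) (f t) j.
Proof.
move=> fe nj sub red; case: (boolP (misses f)) => [fm|fm].
  by exists A, s, t, f.
apply: reducible_embed => //; apply: red; apply: subset_trans sub.
exact: gaps_full.
Qed.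

Lemma serial_edge_disjoint (A B : tgraph) :
  @edge_disjoint A B (serial_sum A B) (@serial_inl A B) (@serial_inr A B).
Proof.
move=> u v /image_relP[x [y [xy <- <-]]] /image_relP[x' [y' [xy' e1 e2]]].
by move: xy; have [-> _] := serial_overlap (esym e1);
  have [-> _] := serial_overlap (esym e2); rewrite adj_irr.
Qed.

(* i = 1 has to be excluded because of the single edge: it is {1,-1}-forcing,
   but every value is a gap of the graph left by deleting it. *)
Lemma tsp_reducible (T : tgraph) : tseries_parallel T ->
  forall i j : 'Z_5, i \in [set 0; 2] -> j \notin sset i ->
  gaps (@src T) tgt != set0 -> gaps (@src T) tgt \subset sset i ->
  reducible (@src T) tgt j.
Proof.
elim=> [|A B _ IHA _ IHB|A B _ IHA _ IHB|G H [f [[g fK gK] fE fs ft]] _ IH] i j i02 ji.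
- move=> _ /subsetP/(_ 1) sub.
  have : 1 \in sset i.
    apply: sub; apply/gapsP; exists (fun b : bool => if b then 1 else 0).
    by split; [case=> -[] | exact: subr0].
  by move: i02; rewrite !inE => /orP[]/eqP->.
- have ov := @serial_overlap A B.
  have gP x := @gaps_serial A B _ _ _ (@serial_inl_inj A B) (@serial_inr_inj A B)
    src tgt src tgt x (esym (serial_inr_src A B)) ov.
  move=> /set0Pn[_ /gP[a0 [b0 [Ha0 Hb0 _]]]] /subsetP sub.
  (* Gaps are closed under negation, so both [a + b] and [a - b] are gaps of the serial sum. *)
  have sumP a b : a \in gaps (@src A) tgt -> b \in gaps (@src B) tgt ->
      (a == 0) && (b \in sset i) || (b == 0) && (a \in sset i).
    move=> Ha Hb; apply: sset_sum => //; apply: sub; apply/gP.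
      by exists a, b.
    by exists a, (- b); rewrite gapsN.
  have nA0 : gaps (@src A) tgt != set0 by apply/set0Pn; exists a0.
  have nB0 : gaps (@src B) tgt != set0 by apply/set0Pn; exists b0.
  have fe := glue_embedsl (@serial_inl_inj A B) (@serial_inr_inj A B).
  have ge := glue_embedsr (@serial_inl_inj A B) (@serial_inr_inj A B).
  have dis := @serial_edge_disjoint A B.
  (* If [A] has a nonzero gap, then 0 is the only gap of [B] and the induction goes into [A]. *)
  case: (pickP [pred a in gaps (@src A) tgt | a != 0]) => [a /andP[Ha a_neq0]|A0].
    have B0 b : b \in gaps (@src B) tgt -> b = 0.
      by move=> /(sumP a b Ha); rewrite (negbTE a_neq0) => /andP[/eqP].
    have Ai : gaps (@src A) tgt \subset sset i.
      apply/subsetP => c /sumP/(_ Hb0); rewrite (B0 b0 Hb0) eqxx andTb.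
      by case/orP=> // /andP[/eqP->].
    have [K [s [t [h [he hm hs ht nj]]]]] := IHA i j i02 ji nA0 Ai.
    (* [K] replaces [A] in the sum; as [B] contributes only 0, [j] stays excluded. *)
    have fhi : injective (@serial_inl A B \o h) := inj_comp fe.1 he.1.
    have gki : injective (@serial_inr A B \o id) := ge.1.
    have idB : @embeds B B id by split.
    have [|ie im] := @glue_misses A B _ _ (serial_sum A B) _ _ _ _
      fhi gki fe ge he idB dis; first by rewrite hm.
    exists (glue fhi gki), ((@serial_inl A B \o h) s), (serial_inr A tgt), id.
    split=> //; first by rewrite /= hs.
    apply/negP => /(gaps_serial fhi gki) H.
    have [|x y /= /ov[xt ->]|c [b [Hc /B0 -> jE]]] := H t src.
    + by rewrite /= ht serial_inr_src.
    + by split=> //; apply: he.1; rewrite ht.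
    by move: nj; rewrite jE addr0 Hc.
  have A0' a : a \in gaps (@src A) tgt -> a = 0.
    by move=> Ha; have := A0 a; rewrite /= Ha => /negbFE/eqP.
  have Bi : gaps (@src B) tgt \subset sset i.
    apply/subsetP => c /(sumP _ _ Ha0); rewrite (A0' a0 Ha0) eqxx andTb.
    by case/orP=> // /andP[/eqP->].
  have [K [s [t [h [he hm hs ht nj]]]]] := IHB i j i02 ji nB0 Bi.
  have fhi : injective (@serial_inl A B \o id) := fe.1.
  have gki : injective (@serial_inr A B \o h) := inj_comp ge.1 he.1.
  have idA : @embeds A A id by split.
  have [|ie im] := @glue_misses A B _ _ (serial_sum A B) _ _ _ _
    fhi gki fe ge idA he dis; first by rewrite hm orbT.
  exists (glue fhi gki), (serial_inl B src), ((@serial_inr A B \o h) t), id.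
  split=> //; first by rewrite /= ht.
  apply/negP => /(gaps_serial fhi gki) H.
  have [|x y /= /ov[-> ys]|a [b [/A0' -> Hb jE]]] := H tgt s.
  + by rewrite /= hs serial_inr_src.
  + by split=> //; apply: he.1; rewrite hs.
  by move: nj; rewrite jE add0r Hb.
- have := gaps_parallel (@parallel_inl_inj A B) (@parallel_inr_inj A B)
    (esym (parallel_inr_src A B)) (esym (parallel_inr_tgt A B)) (@parallel_overlap A B).
  move=> gE n0 sub.
  have fe := glue_embedsl (@parallel_inl_inj A B) (@parallel_inr_inj A B).
  have ge := glue_embedsr (@parallel_inl_inj A B) (@parallel_inr_inj A B).
  (* The gaps of the sum are an intersection, so one part already lacks [j]. *)
  have /nandP[nj|nj] : ~~ ((j \in gaps (@src A) tgt) && (j \in gaps (@src B) tgt)).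
    by rewrite -in_setI -gE; apply: contra ji; apply: (subsetP sub).
    apply: (reducible_part fe nj sub); apply: IHA => //.
    by apply: contraNneq n0 => A0; rewrite gE A0 set0I.
  have gs := parallel_inr_src A B; have gt := parallel_inr_tgt A B.
  rewrite /= -gs -gt; apply: (@reducible_part _ _ _ _ _ (sset i) _ ge nj).
    by rewrite gs gt.
  apply: IHB => //.
  by apply: contraNneq n0 => A0; rewrite gE A0 setI0.
have fe : embeds f by split; [exact: can_inj fK | move=> x y; rewrite fE].
have ff : ~~ misses f.
  apply/missesP => -[u [v [uv]]]; apply; apply/image_relP.
  by exists (g u), (g v); rewrite -fE !gK.
rewrite -fs -ft => n0 sub; apply: reducible_embed => //.
apply: (IH i) => //.
  by apply: contraNneq n0 => G0; rewrite -subset0 -G0; apply: gaps_embed.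
by apply: subset_trans sub; apply: gaps_full.
Qed.

(** * Symmetric subsets of ['Z_5] *)

Lemma symmetric_eq (S T : {set 'Z_5}) :
  (forall x, (- x \in S) = (x \in S)) -> (forall x, (- x \in T) = (x \in T)) ->
  (0 \in S) = (0 \in T) -> (1 \in S) = (1 \in T) -> (2 \in S) = (2 \in T) -> S = T.
Proof.
by move=> sS sT e0 e1 e2; apply/setP; apply: Z5_ind; rewrite ?sS ?sT.
Qed.

Lemma ssetN i x : (- x \in sset i) = (x \in sset i).
Proof. by rewrite !inE eqr_oppLR eqr_opp orbC. Qed.

Lemma sbarN i x : (- x \in sbar i) = (x \in sbar i).
Proof. by rewrite !in_setC ssetN. Qed.

Local Ltac same_set := apply: symmetric_eq;
  [assumption | exact: ssetN || exact: sbarN | rewrite !inE; assumption ..].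

Local Ltac same_sets :=
  first [left; split; same_set | right; split; same_set].

Local Ltac complementary i :=
  left; exists i; split; [by rewrite !inE | same_sets].

Local Ltac singletons i j :=
  right; exists i, j; split; [by rewrite !inE | by rewrite !inE | same_sets].

(** Up to sign there are three classes, so two disjoint nonempty unions of classes either are
    complementary or are single classes; of two distinct classes one is that of 0 or 2, which gives
    [i]. *)
Lemma symmetric_disjoint (S T : {set 'Z_5}) :
  (forall x, (- x \in S) = (x \in S)) -> (forall x, (- x \in T) = (x \in T)) ->
  S != set0 -> T != set0 -> (forall x, x \in S -> x \in T -> False) ->
  (exists i, i \in [set 0; 1; 2] /\
     ((S = sset i /\ T = sbar i) \/ (S = sbar i /\ T = sset i))) \/
  (exists i j, [/\ i \in [set 0; 2], j \notin sset i &
     (S = sset i /\ T = sset j) \/ (S = sset j /\ T = sset i)]).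
Proof.
move=> sS sT S0 T0 dis.
have nonempty (R : {set 'Z_5}) : (forall x, (- x \in R) = (x \in R)) ->
    R != set0 -> [|| 0 \in R, 1 \in R | 2 \in R].
  by move=> sR /set0Pn[]; apply: Z5_ind; rewrite ?sR => ->; rewrite ?orbT.
move: (nonempty S sS S0) (nonempty T sT T0) (@dis 0) (@dis 1) (@dis 2).
case S_0: (0 \in S); case S_1: (1 \in S); case S_2: (2 \in S) => //= _;
case T_0: (0 \in T); case T_1: (1 \in T); case T_2: (2 \in T) => //= _;
move=> d0 d1 d2; try by [case: d0 | case: d1 | case: d2].
all: first [complementary (0 : 'Z_5) | complementary (1 : 'Z_5)
  | complementary (2 : 'Z_5) | singletons (0 : 'Z_5) (1 : 'Z_5)
  | singletons (0 : 'Z_5) (2 : 'Z_5) | singletons (2 : 'Z_5) (1 : 'Z_5)].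
Qed.

(** * Critical graphs pasted from two parts at the terminals *)

(** [G] is the parallel sum of [A] and [B] up to isomorphism and isolated vertices, but keeps its
    own vertex type. *)
Definition pasted (A B : tgraph) (G : sgraph) (f : A -> G) (g : B -> G) :=
  [/\ embeds f, embeds g, f src = g src /\ f tgt = g tgt,
      forall x y, f x = g y -> (x = src /\ y = src) \/ (x = tgt /\ y = tgt) &
      forall u v, adj u v -> image_rel f u v || image_rel g u v].

Lemma pasted_sym (A B : tgraph) (G : sgraph) (f : A -> G) (g : B -> G) :
  pasted f g -> pasted g f.
Proof.
move=> [fe ge [es et] ov cover]; split=> //.
  by move=> y x /esym/ov[[-> ->]|[-> ->]]; [left | right].
by move=> u v /cover; rewrite orbC.
Qed.

Section Pasted.
Variables (A B : tgraph) (G : sgraph) (f : A -> G) (g : B -> G).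
Hypothesis fg : pasted f g.

Lemma pasted_iso : no_isolated G -> sg_iso G (parallel_sum A B).
Proof.
case: fg => [[fi fh] [gi gh] [es et] ov cover] noiso.
pose h (v : parallel_sum A B) : G :=
  match v with inl x => f x | inr y => g (val y) end.
have hl x : h (parallel_inl B x) = f x by [].
have hr y : h (parallel_inr A y) = g y.
  rewrite /parallel_inr; case: insubP => [u _ <- //|].
  move=> /nandP[]/negPn/eqP-> /=; rewrite ?eqxx //.
  by rewrite eq_sym (negbTE (src_neq_tgt B)).
have hi : injective h.
  move=> [x|[y py]] [x'|[y' py']] /=.
  - by move=> /fi ->.
  - case/andP: (py') => /eqP ns /eqP nt /ov ends.
    by case: ends => -[_ e]; [case: ns | case: nt].
  - case/andP: (py) => /eqP ns /eqP nt /esym/ov ends.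
    by case: ends => -[_ e]; [case: ns | case: nt].
  by move=> /gi e; congr inr; apply: val_inj.
(* Every vertex of [G] lies on an edge, and that edge comes from one of the parts. *)
have hs u : exists v, h v == u.
  have [w /cover/orP[]/image_relP[x [y [_ <- _]]]] := noiso u.
    by exists (parallel_inl B x).
  by exists (parallel_inr A x); rewrite hr.
have hE x y : adj (h x) (h y) = adj x y.
  apply/idP/idP => [/cover/orP[]/image_relP[a [b [ab]]]|].
  - rewrite -!hl => /hi <- /hi <-.
    exact: (glue_embedsl (@parallel_inl_inj A B) (@parallel_inr_inj A B)).2.
  - rewrite -!hr => /hi <- /hi <-.
    exact: (glue_embedsr (@parallel_inl_inj A B) (@parallel_inr_inj A B)).2.
  move=> /orP[]/image_relP[a [b [ab <- <-]]].
    by rewrite !hl; apply: fh.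
  by rewrite !hr; apply: gh.
pose k u := xchoose (hs u).
have kK : cancel k h by move=> u; apply/eqP/(xchooseP (hs u)).
exists k; last by move=> x y; rewrite -hE !kK.
by exists h => // x; apply: hi; rewrite kK.
Qed.

Hypothesis crit : critical (cycle_graph 5) G.

Lemma pasted_disjoint x :
  x \in gaps (@src A) tgt -> x \in gaps (@src B) tgt -> False.
Proof.
case: fg => [[fi fh] [gi gh] [es et] ov cover] xA xB; case: crit => ncol _.
apply: ncol.
have : x \in @gaps (glue fi gi) (f src) (f tgt).
  by rewrite (gaps_parallel fi gi es et ov) inE xA.
by move=> /gapsP[phi [col _]]; exists phi => u v /cover; apply: col.
Qed.

Hypotheses (A_neq0 : gaps (@src A) tgt != set0) (B_neq0 : gaps (@src B) tgt != set0).

(** A shared edge has terminals as its ends, so it joins source to target in both parts. All gaps of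
    either part are then 1 or -1, and by symmetry 1 is a common gap, against disjointness. *)
Lemma pasted_edge_disjoint : edge_disjoint f g.
Proof.
have edge_gap (T : tgraph) : gaps (@src T) tgt != set0 -> @adj T src tgt ->
    1 \in gaps (@src T) tgt.
  move=> /set0Pn[x xT] st; have /gapsP[phi [col e]] := xT.
  have := col _ _ st; rewrite /= /cycle_rel -opprB e.
  by rewrite eqr_opp eqr_oppLR => /orP[]/eqP xE; move: xT; rewrite xE ?gapsN.
case: fg => [_ _ _ ov _] u v /image_relP[x [y [xy <- <-]]].
move=> /image_relP[x' [y' [xy' e1 e2]]].
have [stA stB] : @adj A src tgt /\ @adj B src tgt.
  move: xy xy'; case: (ov _ _ (esym e1)) => -[-> ->];
    case: (ov _ _ (esym e2)) => -[-> ->]; rewrite ?adj_irr //.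
  by rewrite ![adj tgt _]adj_sym.
exact: (pasted_disjoint (edge_gap A A_neq0 stA) (edge_gap B B_neq0 stB)).
Qed.

(** Putting [K] in place of [A] leaves a proper subgraph of [G], by edge-disjointness, and
    criticality colours it. *)
Lemma pasted_proper (K : sgraph) (s t : K) (h : K -> A) :
  embeds h -> misses h -> h s = src -> h t = tgt ->
  exists x, x \in gaps s t /\ x \in gaps (@src B) tgt.
Proof.
move=> he hm hs ht; have dis := pasted_edge_disjoint.
case: fg => [fe ge [es et] ov cover].
have fhi : injective (f \o h) := inj_comp fe.1 he.1.
have gi : injective (g \o id) := ge.1.
have idB : @embeds B B id by split.
have [|ie im] := glue_misses fhi gi fe ge he idB dis; first by rewrite hm.
have := critical_misses crit ie im.
move=> /(colourable_gaps ((f \o h) s : glue fhi gi) ((f \o h) t)).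
rewrite (@gaps_parallel _ _ _ _ _ fhi gi s t src tgt) /= ?hs ?ht //.
  by move=> /set0Pn[x]; rewrite in_setI => /andP[xK xB]; exists x.
move=> x y /ov[[xs ->]|[xt ->]]; [left | right]; split=> //.
  by apply: he.1; rewrite hs.
by apply: he.1; rewrite ht.
Qed.

(** A proper subgraph of [A] with the same terminals shares a gap with [B], while [A] shares none,
    so their gap sets differ. *)
Lemma pasted_minforcing : tseries_parallel A ->
  minforcing_family (gaps (@src A) tgt) A.
Proof.
move=> tspA; split=> //; split; first exact/forcingP.
move=> H sH tH prop /forcingP[_ HE].
have [ve vm] := proper_misses (tsp_no_isolated tspA) prop.
have [x [xH xB]] := @pasted_proper (sub_graph H) (exist _ src sH)
  (exist _ tgt tH) _ ve vm erefl erefl.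
by apply: (pasted_disjoint _ xB); rewrite HE.
Qed.

(** A proper subgraph of [A] avoiding the gap [j] also avoids [- j], so it would share no gap with
    [B]. *)
Lemma pasted_not_reducible (i j : 'Z_5) : tseries_parallel A ->
  i \in [set 0; 2] -> j \notin sset i ->
  gaps (@src A) tgt = sset i -> gaps (@src B) tgt = sset j -> False.
Proof.
move=> tspA i02 ji Ai Bj.
have [|K [s [t [h [he hm hs ht nj]]]]] := tsp_reducible tspA i02 ji A_neq0.
  by rewrite Ai.
have [x [xK]] := pasted_proper he hm hs ht.
by rewrite Bj => /set2P[] xj; move: xK; rewrite xj ?gapsN (negbTE nj).
Qed.

End Pasted.

(** * Decomposing a critical graph *)

Definition decomposes (G : sgraph) :=
  exists i : 'Z_5, i \in [set 0; 1; 2] /\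
    exists G1 G2 : tgraph,
      [/\ minforcing_family (sset i) G1, minforcing_family (sbar i) G2
        & sg_iso G (parallel_sum G1 G2)].

Lemma critical_pasted (A B : tgraph) (G : sgraph) (f : A -> G) (g : B -> G) :
  critical (cycle_graph 5) G -> no_isolated G -> pasted f g ->
  tseries_parallel A -> tseries_parallel B ->
  gaps (@src A) tgt != set0 -> gaps (@src B) tgt != set0 -> decomposes G.
Proof.
move=> crit noiso fg tspA tspB A0 B0; have gf := pasted_sym fg.
have minA := pasted_minforcing fg crit A0 B0 tspA.
have minB := pasted_minforcing gf crit B0 A0 tspB.
have [[i [i012 [[Ai Bi]|[Ai Bi]]]]|[i [j [i02 ji [[Ai Bj]|[Aj Bi]]]]]] :=
  symmetric_disjoint (gapsN _ _) (gapsN _ _) A0 B0 (pasted_disjoint fg crit).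
- exists i; split=> //; exists A, B; rewrite -Ai -Bi; split=> //.
  exact: pasted_iso fg noiso.
- exists i; split=> //; exists B, A; rewrite -Ai -Bi; split=> //.
  exact: pasted_iso gf noiso.
- by case: (pasted_not_reducible fg crit A0 B0 tspA i02 ji Ai Bj).
by case: (pasted_not_reducible gf crit B0 A0 tspB i02 ji Bi Aj).
Qed.

(* G is kept apart from T so that the induction survives a parallel sum one
   of whose parts is already all of G. *)
Lemma critical_decomposes (T : tgraph) : tseries_parallel T ->
  forall (G : sgraph) (f : T -> G), critical (cycle_graph 5) G ->
  no_isolated G -> embeds f -> ~~ misses f -> decomposes G.
Proof.
elim=> [|A B tA IHA tB IHB|A B tA IHA tB IHB|T' H [k [[l kK lK] kE ks kt]] _ IH]
  G f crit noiso fe ff.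
- case: crit => ncol _; case: ncol; apply/(colourable_gaps (f false) (f true)).
  apply/set0Pn; exists 1.
  apply: (subsetP (@gaps_full _ _ _ (false : single_edge) true fe ff)).
  apply/gapsP; exists (fun b : bool => if b then 1 else 0).
  by split; [case=> -[] | exact: subr0].
- have le := glue_embedsl (@serial_inl_inj A B) (@serial_inr_inj A B).
  have re := glue_embedsr (@serial_inl_inj A B) (@serial_inr_inj A B).
  have dis := @serial_edge_disjoint A B.
  (* Each summand has an edge and they share none, so each misses an edge and is colourable by
     criticality; the two colourings then combine, so a serial sum is never critical. *)
  have lm : @misses A (serial_sum A B) (@serial_inl A B).
    apply/missesP; have [y sy] := tsp_no_isolated tB src.
    exists (serial_inr A src), (serial_inr A y); split; first exact: re.2.
    by move=> /dis; apply; apply/image_relP; exists src, y.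
  have rm : @misses B (serial_sum A B) (@serial_inr A B).
    apply/missesP; have [y sy] := tsp_no_isolated tA src.
    exists (serial_inl B src), (serial_inl B y); split; first exact: le.2.
    by move=> /(dis _ _ _); apply; apply/image_relP; exists src, y.
  have cA := critical_misses crit (embeds_comp le fe) (misses_comp lm fe).
  have cB := critical_misses crit (embeds_comp re fe) (misses_comp rm fe).
  move/(colourable_gaps (@src A) tgt): cA => /set0Pn[a Ha].
  move/(colourable_gaps (@src B) tgt): cB => /set0Pn[b Hb].
  case: crit => ncol _; case: ncol.
  apply/(colourable_gaps (f (serial_inl B src)) (f (serial_inr A tgt))).
  apply/set0Pn; exists (a + b); apply: (subsetP (gaps_full _ _ fe ff)).
  apply/(@gaps_serial A B _ _ _ (@serial_inl_inj A B) (@serial_inr_inj A B)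
    src tgt src tgt _ (esym (serial_inr_src A B)) (@serial_overlap A B)).
  by exists a, b.
- have le := glue_embedsl (@parallel_inl_inj A B) (@parallel_inr_inj A B).
  have re := glue_embedsr (@parallel_inl_inj A B) (@parallel_inr_inj A B).
  have fle := embeds_comp le fe; have fre := embeds_comp re fe.
  case: (boolP (misses (f \o @parallel_inl A B))) => [lm|]; last exact: IHA fle.
  case: (boolP (misses (f \o @parallel_inr A B))) => [rm|]; last exact: IHB fre.
  have /(colourable_gaps (@src A) tgt) A0 := critical_misses crit fle lm.
  have /(colourable_gaps (@src B) tgt) B0 := critical_misses crit fre rm.
  apply: (@critical_pasted A B G (f \o @parallel_inl A B) (f \o @parallel_inr A B)) => //.
  split=> //.
  + by rewrite /= parallel_inr_src parallel_inr_tgt.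
  + by move=> x y /fe.1; apply: parallel_overlap.
  move=> u v /(missesPn ff)/image_relP[x [y [xy <- <-]]].
  by case/orP: xy => /image_relP[a [b [ab <- <-]]]; apply/orP; [left | right];
    apply/image_relP; exists a, b.
apply: (IH G (f \o k)) => //.
  by apply: embeds_comp fe; split; [exact: can_inj kK | move=> x y; rewrite kE].
apply/missesP => -[u [v [uv]]]; apply.
have /image_relP[x [y [xy <- <-]]] := missesPn ff uv.
by apply/image_relP; exists (l x), (l y); rewrite -kE /= !lK.
Qed.

(** * From a decomposition back to criticality *)

Lemma minforcing_gap (S : {set 'Z_5}) (A : tgraph) (r : rel A) :
  minimally_forcing S A -> symmetric r ->
  (exists u v, adj u v /\ ~~ r u v) ->
  exists2 phi : A -> 'Z_5,
    (forall u v, adj u v -> r u v -> cycle_rel (phi u) (phi v)) &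
    phi tgt - phi src \notin S.
Proof.
move=> [/forcingP[S0 SE] minA] rsym [u [v [uv nuv]]].
pose q a b := adj a b && r a b.
have qsym : symmetric q by move=> a b; rewrite /q adj_sym rsym.
have qP a b : q a b -> [/\ adj a b, a \in [set: A] & b \in [set: A]].
  by move=> /andP[ab _]; rewrite !in_setT.
pose H := Subgraph qsym qP.
have prop : proper_subgraph H.
  by right; exists u, v; rewrite uv /= /q negb_and nuv orbT.
have := minA H (in_setT _) (in_setT _) prop.
set K := sub_tgraph _ _ => nforc.
have sub : S \subset gaps (@src K) tgt.
  apply/subsetP => x; rewrite SE => /gapsP[phi [col <-]].
  by apply/gapsP; exists (phi \o val); split=> // a b /andP[ab _]; apply: col.
(* Every gap in [S] survives the deletion, so no longer being [S]-forcing means having gained a gap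
   outside [S]. *)
have /subsetPn[x /gapsP[phi [col xE]] nx] : ~~ (gaps (@src K) tgt \subset S).
  apply/negP => sub'; apply: nforc; apply/forcingP; split=> //.
  by apply/eqP; rewrite eqEsubset sub.
exists (fun a => phi (exist _ a (in_setT a))); last first.
  suff -> : phi (exist _ tgt (in_setT tgt)) - phi (exist _ src (in_setT src)) = x by [].
  by rewrite -xE; congr (phi _ - phi _); apply: val_inj.
by move=> a b ab rab; apply: col; apply/andP.
Qed.

Lemma forcing_colouring (S : {set 'Z_5}) (A : tgraph) x : forcing S A -> x \in S ->
  exists2 phi : A -> 'Z_5, colouring5 A phi & phi tgt - phi src = x.
Proof. by move=> /forcingP[_ ->] /gapsP[phi [col e]]; exists phi. Qed.

Lemma decomposes_critical (G : sgraph) : no_isolated G -> decomposes G ->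
  critical (cycle_graph 5) G.
Proof.
move=> noiso [i [_ [A [B [[_ minA] [_ minB] [k [l kK lK] kE]]]]]].
have [/forcingP[A0 AE] _] := minA; have [/forcingP[B0 BE] _] := minB.
have fi := @parallel_inl_inj A B; have gi := @parallel_inr_inj A B.
have es := esym (parallel_inr_src A B); have et := esym (parallel_inr_tgt A B).
have le := glue_embedsl fi gi; have re := glue_embedsr fi gi.
have lE x y : adj (l x) (l y) = adj x y by rewrite -kE !lK.
have gE := gaps_parallel fi gi es et (@parallel_overlap A B).
split.
  move=> [phi col].
  have : colourable (cycle_graph 5) (glue fi gi).
    by exists (phi \o l) => u v; rewrite -lE; apply: col.
  move=> /(colourable_gaps (parallel_inl B src : glue fi gi) (parallel_inl B tgt)).
  by rewrite gE -AE -BE setICr eqxx.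
move=> H prop.
(* To colour [H] it is enough to respect the edges it keeps from each part, with one common gap. *)
have paste (phi : A -> 'Z_5) (psi : B -> 'Z_5) :
    (forall a b, adj a b -> sub_adj H (l (parallel_inl B a)) (l (parallel_inl B b)) ->
       cycle_rel (phi a) (phi b)) ->
    (forall a b, adj a b -> sub_adj H (l (parallel_inr A a)) (l (parallel_inr A b)) ->
       cycle_rel (psi a) (psi b)) ->
    phi tgt - phi src = psi tgt - psi src -> colourable (cycle_graph 5) (sub_graph H).
  move=> colA colB e.
  pose psi' y := psi y + (phi src - psi src).
  have psiE : psi' tgt = phi tgt by rewrite /psi' addrCA -e addrC subrK.
  have [|chi [chil chir]] := @common_extension _ _ _ 'Z_5 0 _ _ phi psi' fi gi.
    move=> a b /parallel_overlap[[-> ->]|[-> ->]]; last by rewrite psiE.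
    by rewrite /psi' addrC subrK.
  exists (chi \o k \o val) => u v uv /=.
  have [uvG _ _] := sub_adjP uv.
  move: uvG; rewrite -kE => /orP[]/image_relP[a [b [ab ea eb]]]; rewrite -ea -eb.
    by rewrite !chil; apply: colA => //; rewrite ea eb !kK.
  rewrite !chir /cycle_rel /psi' opprD addrACA subrr addr0.
  by apply: colB => //; rewrite ea eb !kK.
have [_ /missesP[u [v [uv nuv]]]] := proper_misses noiso prop.
have {}nuv : ~~ sub_adj H u v.
  apply/negP => Huv; have [_ uH vH] := sub_adjP Huv.
  by apply: nuv; apply/image_relP; exists (exist _ u uH), (exist _ v vH).
move: uv; rewrite -kE => /orP[]/image_relP[a [b [ab ea eb]]].
  (* The missing edge comes from [A]: what remains of [A] has a gap outside [sset i], hence in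
     [sbar i], which [B] realises. *)
  have [||phi colA nphi] := @minforcing_gap _ _
    (fun a b => sub_adj H (l (parallel_inl B a)) (l (parallel_inl B b))) minA.
  - by move=> x y; apply: sub_adj_sym.
  - by exists a, b; rewrite ea eb !kK.
  have [|psi colB e] := forcing_colouring minB.1 (x := phi tgt - phi src).
    by rewrite inE.
  by apply: (paste phi psi) => // x y xy _; apply: colB.
(* The missing edge comes from [B], and the gap gained lies in [sset i], which [A] realises. *)
have [||psi colB npsi] := @minforcing_gap _ _
  (fun a b => sub_adj H (l (parallel_inr A a)) (l (parallel_inr A b))) minB.
- by move=> x y; apply: sub_adj_sym.
- by exists a, b; rewrite ea eb !kK.
have [|phi colA e] := forcing_colouring minA.1 (x := psi tgt - psi src).
  by move: npsi; rewrite inE negbK.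
by apply: (paste phi psi) => // x y xy _; apply: colA.
Qed.

Theorem theorem3p3 (G : sgraph) (spG : series_parallel G) :
  critical (cycle_graph 5) G <->
  exists i : 'Z_5, i \in [set 0; 1; 2] /\
    exists G1 G2 : tgraph,
      [/\ minforcing_family (sset i) G1, minforcing_family (sbar i) G2
        & sg_iso G (parallel_sum G1 G2)].
Proof.
case: spG => s [t [st tspG]]; have noiso := tsp_no_isolated tspG.
split=> [crit|]; last exact: decomposes_critical.
apply: (critical_decomposes tspG (f := id)) => //; first by split.
by apply/missesP => -[u [v [uv]]]; apply; apply/image_relP; exists u, v.
Qed.
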